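(* Let $n,p\in\mathbb{N}$ and $\kappa\in\{1,\dots,n\}$. Let $\xi_1,\dots,\xi_I$ be an enumeration of $\mathcal{I}(n,p)=\{\xi\in\mathbb{N}^\kappa\times\mathbb{N}_0^{n-\kappa}:|\xi|_1\le p\}$. Then the coefficient matrix $\boldsymbol{K}\in\mathbb{R}^{I\times I}$ for $\kappa\ne0$, given by $$K_{i,j}=\sum_{\beta\in\mathcal{G}_j}\mathrm{sgn}\Big(\prod_{l=1}^{\kappa}\beta_l\Big)\,\beta^{2\xi_i-\sum_{l=1}^{\kappa}e_l},\qquad 1\le i,j\le I,$$ is non-singular.
   Context: $\mathbb{N}=\{1,2,\dots\}$, $\mathbb{N}_0=\{0,1,\dots\}$; $|\xi|_1=\sum_l|\xi_l|$; $\beta^{\gamma}=\prod_l\beta_l^{\gamma_l}$ with the convention $0^0=1$; $e_l$ is the $l$-th standard basis vector of $\mathbb{R}^n$. $\mathcal{G}_j$ is the set of distinct vectors $((-1)^{k_1}\xi_{j,1},\dots,(-1)^{k_n}\xi_{j,n})$ with $k_1,\dots,k_n\in\{0,1\}$, where $\xi_{j,l}$ is the $l$-th coordinate of $\xi_j$. If $\mathcal{I}(n,p)=\varnothing$ (i.e. $p<\kappa$) the matrix does not exist and the statement is vacuous. *)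

(* Defs.v *)
From HB Require Import structures.
From mathcomp Require Import all_boot all_order all_algebra finmap reals.

Set Implicit Arguments.
Unset Strict Implicit.
Unset Printing Implicit Defensive.

Import Order.TTheory GRing.Theory Num.Theory.

Local Open Scope ring_scope.

(* Coordinates are numbered from 0, so the first kappa coordinates are those
   with l < kappa. *)

Definition norm1 n (x : 'rV[nat]_n) : nat := (\sum_(l < n) x ord0 l)%N.

Definition index_set (n kappa p : nat) : {pred 'rV[nat]_n} :=
  [pred x : 'rV[nat]_n | [forall l : 'I_n, (l < kappa)%N ==> (0 < x ord0 l)%N]
            && (norm1 x <= p)%N].
Arguments index_set : clear implicits.

Definition is_enumeration (T : eqType) (N : nat) (xi : 'I_N -> T)
    (A : {pred T}) : Prop :=
  injective xi /\ (forall x, x \in A <-> exists i, xi i = x).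

Definition sign_change (R : realType) n (k : {ffun 'I_n -> bool})
    (x : 'rV[nat]_n) : 'rV[R]_n :=
  \row_(l < n) ((-1) ^+ k l * (x 0 l)%:R).

(* A set: sign choices at zero coordinates give the same vector, which is
   counted once. *)
Definition orbit_set (R : realType) n (x : 'rV[nat]_n) : {fset 'rV[R]_n} :=
  [fset sign_change R k x | k in {: {ffun 'I_n -> bool}}]%fset.

Definition monomial (R : realType) n (b : 'rV[R]_n) (g : 'rV[nat]_n) : R :=
  \prod_(l < n) b 0 l ^+ g 0 l.

(* 2 x - sum_(l < kappa) e_l. The subtraction is truncated, but on
   index_set n kappa p it agrees with the one in Z, as x 0 l > 0 there for
   l < kappa. *)
Definition exponent n (kappa : nat) (x : 'rV[nat]_n) : 'rV[nat]_n :=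
  \row_(l < n) (2 * x ord0 l - (l < kappa))%N.

Definition coef_matrix (R : realType) n (kappa N : nat)
    (xi : 'I_N -> 'rV[nat]_n) : 'M[R]_N :=
  \matrix_(i < N, j < N)
    \sum_(b <- orbit_set R (xi j))
      Num.sg (\prod_(l < n | (l < kappa)%N) b 0 l)
      * monomial b (exponent kappa (xi i)).

(* Main.v *)
(** Up to the sign change, all terms of [K i j] coincide, so that
    [K i j = #|G_j| * \prod_l xi_j,l ^ (2 xi_i,l - [l < kappa])]. It remains to
    see that a vector [w] with [\sum_j w_j xi_j ^ (2 xi_i - e) = 0] for all [i]
    vanishes. The index set is stable under decreasing coordinates (down to 1
    in the first kappa ones), hence it contains all exponents of the tensor
    products [N_a] of the Newton polynomials
    [x ^ e_l * \prod_(e_l <= k < a_l) (x ^ 2 - k ^ 2)], [a] in the index set.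
    As [N_a] vanishes at [x] unless [a <= x] coordinatewise, and
    [N_a] does not vanish at [a], downward induction on [|a|_1] yields [w = 0]. *)

Require Import Defs.
From HB Require Import structures.
From mathcomp Require Import all_boot all_order all_algebra finmap reals.
From mathcomp Require Import zify.

Set Implicit Arguments.
Unset Strict Implicit.
Unset Printing Implicit Defensive.

Import Order.TTheory GRing.Theory Num.Theory.

Local Open Scope ring_scope.

Definition newton_poly (R : nzRingType) (e a : nat) : {poly R} :=
  \prod_(k <- index_iota e a) ('X - ((k ^ 2)%:R)%:P).

Lemma size_newton_poly (R : nzRingType) (e a : nat) :
  size (newton_poly R e a) = (a - e).+1.
Proof. by rewrite /newton_poly size_prod_XsubC size_iota. Qed.

Lemma newton_poly_eq0 (R : numDomainType) (e a x : nat) :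
  ((newton_poly R e a).[(x ^ 2)%:R] == 0) = (e <= x < a)%N.
Proof.
rewrite /newton_poly horner_prod prodf_seq_eq0 -mem_index_iota.
apply/hasP/idP => [[k ka]|xa].
  by rewrite hornerXsubC subr_eq0 eqr_nat eqn_exp2r // => /eqP ->.
by exists x; rewrite // hornerXsubC subrr eqxx.
Qed.

(** The bound [q] does not depend on [a], so that all coordinates can later share one index type.
    The exponent has the shape of an entry of [exponent] at the shifted index [m + e]. *)
Lemma horner_newton_polyM (R : comNzRingType) (e : bool) (a q x : nat) :
    (a <= q)%N ->
  x%:R ^+ e * (newton_poly R e a).[(x ^ 2)%:R] =
  \sum_(m < q.+1) (newton_poly R e a)`_m * x%:R ^+ (2 * (m + e) - e).
Proof.
move=> aq; rewrite (@horner_coef_wide _ q.+1); last first.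
  by rewrite size_newton_poly ltnS; lia.
rewrite mulr_sumr; apply: eq_bigr => m _.
rewrite mulrCA natrX -exprM -exprD; congr (_ * _ ^+ _).
by case: e; lia.
Qed.

Definition nat_monomial (R : nzRingType) n (x g : 'rV[nat]_n) : R :=
  \prod_(l < n) (x ord0 l)%:R ^+ g ord0 l.

Lemma index_setP (n kappa p : nat) (x : 'rV[nat]_n) :
  reflect ((forall l : 'I_n, ((l < kappa) <= x ord0 l)%N) /\ (norm1 x <= p)%N)
          (x \in index_set n kappa p).
Proof.
rewrite inE; apply: (iffP andP) => [[/forallP h1 h2]|[h1 h2]]; split => //.
  by move=> l; move: (h1 l); case: (l < kappa)%N.
by apply/forallP => l; move: (h1 l); case: (l < kappa)%N.
Qed.

Lemma leq_coord_norm1 n (x : 'rV[nat]_n) (l : 'I_n) : (x ord0 l <= norm1 x)%N.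
Proof. by rewrite /norm1 (bigD1 l) //= leq_addr. Qed.

Lemma norm1_lt n (x y : 'rV[nat]_n) :
  (forall l, (x ord0 l <= y ord0 l)%N) -> x <> y -> (norm1 x < norm1 y)%N.
Proof.
move=> xy neq; rewrite ltn_neqAle leq_sum // andbT.
apply/eqP => eqs; apply: neq; apply/rowP => l; apply/eqP.
have := leqif_sum (fun (l : 'I_n) (_ : true) => leqif_eq (xy l)).
by case=> _; rewrite -!/(norm1 _) eqs eqxx => /esym/forallP/(_ l).
Qed.

Definition newton_tensor (R : nzRingType) n (kappa : nat) (a x : 'rV[nat]_n) : R :=
  \prod_(l < n) ((x ord0 l)%:R ^+ (l < kappa)%N *
                 (newton_poly R (l < kappa)%N (a ord0 l)).[((x ord0 l) ^ 2)%:R]).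

Lemma newton_tensor_diag_neq0 (R : numDomainType) n (kappa p : nat) (a : 'rV[nat]_n) :
  a \in index_set n kappa p -> newton_tensor R kappa a a != 0.
Proof.
case/index_setP => apos _; apply/prodf_neq0 => l _.
rewrite mulf_neq0 ?newton_poly_eq0 ?ltnn ?andbF //.
move: (apos l); case: (l < kappa)%N => [al|_]; last by rewrite oner_neq0.
by rewrite expf_neq0 // pnatr_eq0 -lt0n.
Qed.

(** As [x] respects the lower bounds [l < kappa], a coordinate of [x] below that of [a] has its
    square among the Newton nodes. *)
Lemma newton_tensor_neq0_leq (R : numDomainType) n (kappa p : nat) (a x : 'rV[nat]_n) :
    x \in index_set n kappa p -> newton_tensor R kappa a x != 0 ->
  forall l, (a ord0 l <= x ord0 l)%N.
Proof.
case/index_setP => xpos _ /prodf_neq0 h l.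
have := h l isT; rewrite mulf_eq0 negb_or newton_poly_eq0 xpos /= => /andP[_].
by rewrite -leqNgt.
Qed.

Lemma newton_tensor_expand (R : comNzRingType) n (kappa p : nat) (a : 'rV[nat]_n) :
    a \in index_set n kappa p ->
  exists c : 'rV[nat]_n -> R, exists s : seq 'rV[nat]_n,
    {subset s <= index_set n kappa p} /\
    forall x, newton_tensor R kappa a x =
              \sum_(g <- s) c g * nat_monomial R x (exponent kappa g).
Proof.
case/index_setP => apos ap.
(* [f] picks a degree in each coordinate; [sh] turns it into an index [g] whose [exponent] is
   [2 f + e], and [cf] undoes the shift. *)
pose sh (f : {ffun 'I_n -> 'I_p.+1}) : 'rV[nat]_n := \row_l (f l + (l < kappa))%N.
pose cf (g : 'rV[nat]_n) : R :=
  \prod_(l < n) (newton_poly R (l < kappa)%N (a ord0 l))`_(g ord0 l - (l < kappa)).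
pose low (f : {ffun 'I_n -> 'I_p.+1}) := [forall l : 'I_n, (f l + (l < kappa) <= a ord0 l)%N].
exists cf, [seq sh f | f <- enum low]; split.
  move=> g /mapP[f]; rewrite mem_enum => /forallP flow ->{g}.
  apply/index_setP; split=> [l|]; first by rewrite mxE leq_addl.
  by apply: leq_trans ap; apply: leq_sum => l _; rewrite mxE.
move=> x; rewrite big_map big_enum /= /newton_tensor.
under [LHS]eq_bigr => l _.
  rewrite (@horner_newton_polyM _ _ _ p);
    last exact: leq_trans (leq_coord_norm1 a l) ap.
over.
rewrite bigA_distr_bigA /= (bigID low) /= [X in _ + X]big1 ?addr0.
  apply: eq_bigr => f _; rewrite /cf /nat_monomial -big_split /=.
  by apply: eq_bigr => l _; rewrite !mxE addnK.
(* Here [f l] exceeds the degree [a_l - e_l], so the coefficient is 0. The bound [e_l <= a_l] keeps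
   this truncated subtraction exact. *)
move=> f /forallPn[l]; rewrite -ltnNge => fl.
rewrite (bigD1 l) //= nth_default ?mul0r // size_newton_poly.
by move: (apos l) fl; lia.
Qed.

Lemma monomial_kernel (R : numDomainType) (n p kappa N : nat)
    (xi : 'I_N -> 'rV[nat]_n) (w : 'I_N -> R) :
    is_enumeration xi (index_set n kappa p) ->
    (forall i, \sum_j w j * nat_monomial R (xi j) (exponent kappa (xi i)) = 0) ->
  forall j, w j = 0.
Proof.
case=> xi_inj xiP wker.
have xi_in j : xi j \in index_set n kappa p by apply/xiP; exists j.
have wnewton a : a \in index_set n kappa p ->
    \sum_j w j * newton_tensor R kappa a (xi j) = 0.
  case/(newton_tensor_expand R) => c [s [sI Ea]].
  under eq_bigr => j _ do rewrite Ea mulr_sumr.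
  (* After the exchange, each exponent [g] is some [xi i], so its inner sum is a multiple of a
     vanishing hypothesis. *)
  rewrite exchange_big /= big_seq big1 // => g /sI /xiP[i <-].
  under eq_bigr => j _ do rewrite mulrCA.
  by rewrite -mulr_sumr wker mulr0.
move=> j; have [m] := ubnP (p - norm1 (xi j)).
elim: m j => // m IHm j jm.
have := wnewton _ (xi_in j); rewrite (bigD1 j) //= big1 ?addr0.
  by move/eqP; rewrite mulf_eq0 (negbTE (newton_tensor_diag_neq0 R (xi_in j))) orbF => /eqP.
(* A surviving [k] has [xi k] dominating [xi j] and distinct from it, hence of larger norm, so [w k]
   is 0 by induction. *)
move=> k kj; have [->|nz] := eqVneq (newton_tensor R kappa (xi j) (xi k)) 0.
  by rewrite mulr0.
have lt_jk : (norm1 (xi j) < norm1 (xi k))%N.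
  apply: norm1_lt (newton_tensor_neq0_leq (xi_in k) nz) _.
  by move/xi_inj => e; rewrite e eqxx in kj.
rewrite IHm ?mul0r //; have /index_setP[_ kp] := xi_in k.
by lia.
Qed.

(** The sign of a coordinate [l < kappa] is absorbed by its odd power, and the other powers are
    even. *)
Lemma sg_monomial_sign_change (R : realType) n (kappa p : nat)
    (k : {ffun 'I_n -> bool}) (x g : 'rV[nat]_n) :
    g \in index_set n kappa p ->
  Num.sg (\prod_(l < n | (l < kappa)%N) sign_change R k x 0 l)
    * monomial (sign_change R k x) (exponent kappa g) =
  nat_monomial R x (exponent kappa g).
Proof.
case/index_setP => gpos _.
rewrite (big_morph _ (@sgrM R) (@sgr1 R)) big_mkcond -big_split /=.
apply: eq_bigr => l _; rewrite !mxE.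
have sqr m : ((-1) ^+ k l * (x ord0 l)%:R : R) ^+ (2 * m) =
      (x ord0 l)%:R ^+ (2 * m).
  by rewrite 2!exprM [_ ^+ 2]exprMn sqrr_sign mul1r.
move: (gpos l); case: ltnP => _ gl; last by rewrite subn0 mul1r sqr.
(* Splitting off one factor [b] of the odd power uses [sg b * b = |b|]. *)
have -> : (2 * g ord0 l - true = (2 * (g ord0 l).-1).+1)%N by lia.
by rewrite !exprS mulrA -normrEsg normrMsign normr_nat sqr.
Qed.

Lemma coef_matrixE (R : realType) n (kappa p N : nat) (xi : 'I_N -> 'rV[nat]_n) i j :
    xi i \in index_set n kappa p ->
  coef_matrix R kappa xi i j =
  (#|` orbit_set R (xi j)|)%:R * nat_monomial R (xi j) (exponent kappa (xi i)).
Proof.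
move=> ii; rewrite mxE big_seq.
rewrite (eq_bigr (fun=> nat_monomial R (xi j) (exponent kappa (xi i)))).
  by rewrite -big_seq big_const_seq count_predT iter_addr addr0 mulr_natl.
by move=> b /imfsetP[k _ ->]; rewrite (sg_monomial_sign_change _ _ _ ii).
Qed.

Lemma orbit_set_gt0 (R : realType) n (x : 'rV[nat]_n) : (0 < #|` orbit_set R x|)%N.
Proof.
by rewrite cardfs_gt0; apply/fset0Pn; exists (sign_change R [ffun=> false] x); apply: in_imfset.
Qed.

Theorem corollary4p15 (R : realType) (n p kappa : nat)
  (hn : (0 < n)%N) (hp : (0 < p)%N) (hkappa : (1 <= kappa <= n)%N)
  (N : nat) (xi : 'I_N -> 'rV[nat]_n)
  (hxi : is_enumeration xi (index_set n kappa p)) :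
  coef_matrix R kappa xi \in unitmx.
Proof.
(* Transposing makes a row kernel vector give the relations [\sum_j K i j * v_j = 0], the form
   treated by [monomial_kernel]. *)
rewrite -unitmx_tr -row_free_unit; apply: inj_row_free => v vK0.
have xi_in i : xi i \in index_set n kappa p by case: (hxi) => _ ->; exists i.
(* The orbit sizes are absorbed into the weights; being nonzero in [R], they cancel at the end. *)
have card_v0 := @monomial_kernel R n p kappa N xi
  (fun j => v 0 j * (#|` orbit_set R (xi j)|)%:R) hxi.
apply/rowP => j; rewrite mxE; apply/eqP.
have := orbit_set_gt0 R (xi j); rewrite lt0n -(pnatr_eq0 R) => /negbTE cj.
rewrite -[_ == 0]orbF -cj -mulf_eq0; apply/eqP/card_v0 => i.
transitivity ((v *m (coef_matrix R kappa xi)^T) 0 i); last by rewrite vK0 mxE.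
by rewrite mxE; apply: eq_bigr => l _; rewrite mxE (@coef_matrixE _ _ _ p) ?mulrA.
Qed.
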